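(* There is a universal constant $c>0$ such that the following holds. Let $G=(\mathcal{X},\mathcal{A},\mu,V)$ be a $k$-player free game with classical value $\mathrm{val}(G)=1-\epsilon$, and let $s=\max_j\log_2|\mathcal{A}_j|$ be the output answer length of the players. Then for all $n\ge1$, $$\mathrm{val}(G^{\otimes n})\le (1-\epsilon^2)^{c\,n/(sk)}.$$
   Context: A $k$-player game is a tuple $G=(\mathcal{X},\mathcal{A},\mu,V)$ with $\mathcal{X}=\prod_j\mathcal{X}_j$, $\mathcal{A}=\prod_j\mathcal{A}_j$ products of finite alphabets, $\mu$ a distribution on $\mathcal{X}$ and $V:\mathcal{X}\times\mathcal{A}\to\{0,1\}$; the referee samples $x\leftarrow\mu$, gives $x_j$ to player $j$, and accepts iff $V(x,a)=1$ on answers $a$. It is free if $\mu=\mu_1\otimes\cdots\otimes\mu_k$. The classical value $\mathrm{val}(G)$ is the maximum acceptance probability over classical strategies, i.e. (without loss of generality) deterministic functions $h_j:\mathcal{X}_j\to\mathcal{A}_j$. The $n$-fold repetition $G^{\otimes n}=(\mathcal{X}^n,\mathcal{A}^n,\mu^{\otimes n},V^n)$ gives player $j$ the $j$-th components of $n$ independent samples of $\mu$ and accepts iff $V^n(\vec x,\vec a)=\prod_{i=1}^nV(\vec x_i,\vec a_i)=1$. *)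

(* Defs.v *)
From HB Require Import structures.
From mathcomp Require Import all_boot all_order all_algebra.
From mathcomp Require Import all_classical all_reals.
From mathcomp Require Import exp.
From mathcomp Require Import Rstruct.
Set Implicit Arguments. Unset Strict Implicit. Unset Printing Implicit Defensive.
Import Order.TTheory GRing.Theory Num.Theory.
Local Open Scope ring_scope.

Notation R := Rdefinitions.R.

Section Games.
Variable k : nat.
Variables (X A : 'I_k -> finType).

Definition qtuple := {dffun forall j : 'I_k, X j}.
Definition atuple := {dffun forall j : 'I_k, A j}.

Definition is_distr (T : finType) (p : T -> R) :=
  (forall t, 0 <= p t) /\ \sum_(t : T) p t = 1.

Definition free_distr (mu : qtuple -> R) :=
  exists muj : forall j : 'I_k, X j -> R,
    (forall j, is_distr (muj j)) /\
    forall x : qtuple, mu x = \prod_(j < k) muj j (x j).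

Definition strategy := {dffun forall j : 'I_k, {ffun X j -> A j}}.

Definition answers (h : strategy) (x : qtuple) : atuple :=
  [ffun j => h j (x j)].

Definition win_prob (mu : qtuple -> R) (V : qtuple -> atuple -> bool)
  (h : strategy) : R :=
  \sum_(x : qtuple) mu x * (V x (answers h x))%:R.

Definition game_val (mu : qtuple -> R) (V : qtuple -> atuple -> bool) : R :=
  \big[Num.max/0]_(h : strategy) win_prob mu V h.

End Games.

Section Repetition.
Variable k n : nat.
Variables (X A : 'I_k -> finType).

Definition repX (j : 'I_k) : finType := {ffun 'I_n -> X j}.
Definition repA (j : 'I_k) : finType := {ffun 'I_n -> A j}.

Definition qcoord (xs : qtuple repX) (i : 'I_n) : qtuple X :=
  [ffun j => xs j i].
Definition acoord (as_ : atuple repA) (i : 'I_n) : atuple A :=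
  [ffun j => as_ j i].

Definition rep_mu (mu : qtuple X -> R) (xs : qtuple repX) : R :=
  \prod_(i < n) mu (qcoord xs i).

Definition rep_V (V : qtuple X -> atuple A -> bool)
  (xs : qtuple repX) (as_ : atuple repA) : bool :=
  [forall i : 'I_n, V (qcoord xs i) (acoord as_ i)].

End Repetition.

Definition log2 (x : R) : R := ln x / ln 2.

Definition answer_len (k : nat) (A : 'I_k -> finType) : R :=
  \big[Num.max/0]_(j < k) log2 #|A j|%:R.

(* Main.v *)
(** Fix a strategy for the repeated game and a set [S] of coordinates. Given the
    questions and answers on [S], the players' remaining questions are still
    independent of each other because the game is free, so on a question [y] for
    coordinate [i] each player can resample her own questions locally. This is a
    randomized strategy for the single game; if it loses with probability
    [f_i y] on [y], then [f_i] has [mu]-average at least [eps].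

    For [lam > 0], compare the two sides of E[1_(win S) exp(- lam sum_i f_i)],
    with [i] outside [S]. A union bound over the answers on [S] makes the
    coordinates independent and bounds it by
    |A|^|S| (1 - (1 - e^-lam) eps)^(n - |S|), while Jensen's inequality bounds
    it below by P(win S) exp(- lam sum_i P(lose i | win S)). Hence, as long as
    [S] is small and P(win S) is not already tiny, some coordinate outside [S]
    is lost with substantial conditional probability, and [S] can be extended by
    it. For [eps] bounded away from [1] take [lam = 1]: about [eps n / (s k)]
    extensions gain a factor [1 - eps / 8] each. For [eps] close to [1] take
    [lam = - ln (1 - eps)]: about [lam n / (s k)] extensions gain a factor
    [1 / 2] each, unless [1 - eps] is so small that the bound
    [(|A| (1 - eps))^n] is enough. *)

Require Import Defs.
From HB Require Import structures.
From mathcomp Require Import all_boot all_order all_algebra.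
From mathcomp Require Import all_classical all_reals.
From mathcomp Require Import exp.
From mathcomp Require Import Rstruct.
(* [exp] is imported again because [Rstruct] shadows [expR0], [expRD], ... *)
From mathcomp Require Import unstable interval_inference sequences convex exp.
From mathcomp Require Import ring lra.
Import Order.TTheory GRing.Theory Num.Theory.
Local Open Scope ring_scope.
Set Implicit Arguments. Unset Strict Implicit. Unset Printing Implicit Defensive.

(** * Sums and products over dependent tuples *)

Lemma bigA_distr_dffun (K : comPzSemiRingType) (I : finType) (T : I -> finType)
    (F : forall i, T i -> K) :
  \sum_(x : {dffun forall i, T i}) \prod_i F i (x i)
  = \prod_i \sum_(t : T i) F i t.
Proof.
rewrite (reindex (@dffun_of_fprod I T)); last exact/onW_bij/dffun_of_fprod_bij.
pose P i := [ffun t => F i t].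
transitivity (\sum_(t : fprod T) \prod_(i in I) P i (t i)).
  by apply: eq_bigr => t _; apply: eq_bigr => i _; rewrite !ffunE.
rewrite big_fprod; transitivity
  (\prod_i \sum_(t in tagged_with T i) untag 0 (P i) t); last first.
  apply: eq_bigr => i _; rewrite -(big_tag (fun i t => P i t)).
  by apply: eq_bigr => t _; rewrite ffunE.
by rewrite (bigA_distr_big_dep (fun i => [pred t | t \in tagged_with T i])).
Qed.

Lemma prodr_bool (K : comPzSemiRingType) (I : finType) (b : pred I) :
  \prod_i (b i)%:R = ([forall i, b i])%:R :> K.
Proof.
have [/forallP bT|/forallPn [i /negbTE bi]] := boolP [forall i, b i].
  by rewrite big1 // => i _; rewrite bT.
by rewrite (bigD1 i) //= bi mul0r.
Qed.

Lemma dffun_eqE (I : finType) (T : I -> eqType) (x y : {dffun forall i, T i}) :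
  (x == y) = [forall i, x i == y i].
Proof.
apply/eqP/forallP => [-> //|xy]; apply/ffunP => i; exact/eqP.
Qed.

(** Splitting the sum by the value of [f] freezes that value, so factors depending on it alone can
    leave the inner sum. *)
Lemma sumr_fiber (I J : finType) (f : I -> J) (F : I -> J -> R) :
  \sum_i F i (f i) = \sum_j \sum_i (f i == j)%:R * F i j.
Proof.
rewrite exchange_big; apply: eq_bigr => i _ /=.
rewrite (bigD1 (f i)) //= eqxx mul1r big1 ?addr0 // => j.
by rewrite eq_sym => /negbTE ->; rewrite mul0r.
Qed.

(** * Locally randomized strategies in the single game *)

Section Resampling.
Variables (k : nat) (X A : 'I_k -> finType).
Variables (mu : qtuple X -> R) (V : qtuple X -> atuple A -> bool) (v : R).
Hypothesis win_le : forall h : strategy X A, win_prob mu V h <= v.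

(** Local randomness can be drawn in advance: if each player fixes an answer to every question
    independently with law [nu], the result is a mixture, with weights [P], of deterministic
    strategies. *)
Lemma randomized_win_le (nu : forall j, X j -> A j -> R) :
    (forall j y a, 0 <= nu j y a) -> (forall j y, \sum_a nu j y a = 1) ->
  \sum_x mu x * (\sum_(a : atuple A) (\prod_j nu j (x j) (a j)) * (V x a)%:R)
    <= v.
Proof.
move=> nu_ge0 nu1.
pose P (h : strategy X A) := \prod_j \prod_(y : X j) nu j y (h j y).
have P_ge0 h : 0 <= P h by apply: prodr_ge0 => j _; apply: prodr_ge0.
have P1 : \sum_h P h = 1.
  rewrite (bigA_distr_dffun (fun j (g : {ffun X j -> A j}) =>
    \prod_(y : X j) nu j y (g y))).
  by rewrite big1 // => j _; rewrite -(bigA_distr_bigA (nu j)) big1.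
have Pa x (a : atuple A) :
    \sum_h (answers h x == a)%:R * P h = \prod_j nu j (x j) (a j).
  (* [N] forces the answer [a j] at the question [x j] only; at every other question the weights
     still sum to 1. *)
  pose N j (y : X j) (b : A j) := ((y == x j) ==> (b == a j))%:R * nu j y b.
  transitivity (\sum_h \prod_j \prod_(y : X j) N j y ((h : strategy X A) j y)).
    apply: eq_bigr => h _; rewrite dffun_eqE -prodr_bool -big_split /=.
    apply: eq_bigr => j _; rewrite big_split /=; congr (_ * _).
    rewrite prodr_bool ffunE; congr (nat_of_bool _)%:R.
    apply/idP/forallP => [/eqP <- y|/(_ (x j))]; last by rewrite eqxx.
    by apply/implyP => /eqP ->.
  rewrite (bigA_distr_dffun (fun j (g : {ffun X j -> A j}) =>
    \prod_(y : X j) N j y (g y))).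
  apply: eq_bigr => j _; rewrite -(bigA_distr_bigA (N j)) (bigD1 (x j)) //=.
  rewrite [X in _ * X]big1 => [|y /negbTE yx]; last first.
    by rewrite -[RHS](nu1 j y); apply: eq_bigr => b _; rewrite /N yx mul1r.
  rewrite mulr1 (bigD1 (a j)) //= /N !eqxx mul1r big1 ?addr0 // => b /negbTE ->.
  by rewrite mul0r.
have -> : \sum_x mu x *
    (\sum_(a : atuple A) (\prod_j nu j (x j) (a j)) * (V x a)%:R)
    = \sum_h P h * win_prob mu V h.
  rewrite /win_prob.
  under [RHS]eq_bigr do rewrite mulr_sumr.
  rewrite exchange_big; apply: eq_bigr => x _ /=.
  under [RHS]eq_bigr do rewrite mulrCA; rewrite -mulr_sumr; congr (_ * _).
  rewrite (sumr_fiber (fun h : strategy X A => answers h x)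
    (fun h a => P h * (V x a)%:R)).
  apply: eq_bigr => a _; rewrite -Pa mulr_suml; apply: eq_bigr => h _.
  by rewrite mulrA.
rewrite -[leRHS]mul1r -P1 mulr_suml; apply: ler_sum => h _.
by rewrite ler_wpM2l.
Qed.

(* [f y] is the probability of losing on question [y] when each player, alone,
   resamples her randomness [w j] conditioned on her own question [y j];
   questions of probability zero are answered by the default [a0]. *)
Lemma resampling (Om : 'I_k -> finType) (w : forall j, Om j -> R)
    (xi : forall j, Om j -> X j) (al : forall j, Om j -> A j)
    (a0 : forall j, A j) :
    \sum_x mu x = 1 -> (forall j u, 0 <= w j u) ->
  exists f : qtuple X -> R,
    [/\ forall y, 0 <= f y <= 1, 1 - v <= \sum_y mu y * f y &
      forall y,
      f y * (\sum_(o : {dffun forall j, Om j})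
              ([ffun j => xi j (o j)] == y :> qtuple X)%:R * \prod_j w j (o j))
      = \sum_(o : {dffun forall j, Om j})
          ([ffun j => xi j (o j)] == y :> qtuple X)%:R *
          ((\prod_j w j (o j)) * (~~ V y [ffun j => al j (o j)])%:R)].
Proof.
move=> mu1 w_ge0.
pose ph j y a := \sum_(u : Om j) ((xi j u == y) && (al j u == a))%:R * w j u.
pose Ph j y := \sum_(u : Om j) (xi j u == y)%:R * w j u.
have ph_ge0 j y a : 0 <= ph j y a.
  by apply: sumr_ge0 => u _; rewrite mulr_ge0.
have sum_ph j y : \sum_a ph j y a = Ph j y.
  rewrite /Ph (sumr_fiber (al j) (fun u _ => (xi j u == y)%:R * w j u)).
  apply: eq_bigr => a _; apply: eq_bigr => u _.
  by rewrite mulrA -natrM mulnb andbC.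
have Ph_ge0 j y : 0 <= Ph j y by rewrite -sum_ph sumr_ge0.
pose nu j y a := if Ph j y == 0 then (a == a0 j)%:R else ph j y a / Ph j y.
have nu_ge0 j y a : 0 <= nu j y a.
  by rewrite /nu; case: ifP => // _; rewrite divr_ge0.
have nu1 j y : \sum_a nu j y a = 1.
  rewrite /nu; have [_|?] := eqVneq (Ph j y) 0; last first.
    by rewrite -mulr_suml sum_ph divff.
  by rewrite (bigD1 (a0 j)) //= eqxx big1 ?addr0 // => a /negbTE ->.
(* Where [Ph] vanishes, so does every nonnegative term [ph], so the factorization survives the
   default answer. *)
have phE j y a : ph j y a = nu j y a * Ph j y.
  rewrite /nu; case: ifP => [/eqP P0|/negbT ?]; last by rewrite divfK.
  rewrite P0 mulr0; move: P0; rewrite -sum_ph => /eqP.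
  by rewrite psumr_eq0 // => /allP/(_ a (mem_index_enum a))/eqP.
have nuA1 (y : qtuple X) : \sum_(a : atuple A) \prod_j nu j (y j) (a j) = 1.
  by rewrite (bigA_distr_dffun (fun j b => nu j (y j) b)) big1.
pose f (y : qtuple X) :=
  \sum_(a : atuple A) (\prod_j nu j (y j) (a j)) * (~~ V y a)%:R.
have nuA_ge0 (y : qtuple X) (a : atuple A) : 0 <= \prod_j nu j (y j) (a j).
  by apply: prodr_ge0.
have fE y : f y = 1 - \sum_(a : atuple A) (\prod_j nu j (y j) (a j)) * (V y a)%:R.
  rewrite -[X in _ = X - _](nuA1 y) -sumrB; apply: eq_bigr => a _.
  by case: (V y a) => /=; rewrite !(mulr0, mulr1, subrr, subr0).
exists f; split => [y|| y].
- apply/andP; split; first by apply: sumr_ge0 => a _; rewrite mulr_ge0.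
  by rewrite fE gerBl sumr_ge0 // => a _; rewrite mulr_ge0.
- under eq_bigr do rewrite fE mulrBr mulr1.
  by rewrite sumrB mu1 lerD2l lerN2 randomized_win_le.
have -> : \sum_(o : {dffun forall j, Om j})
    ([ffun j => xi j (o j)] == y :> qtuple X)%:R * \prod_j w j (o j)
    = \prod_j Ph j (y j).
  rewrite -(bigA_distr_dffun (fun j u => (xi j u == y j)%:R * w j u)).
  apply: eq_bigr => o _; rewrite dffun_eqE -prodr_bool big_split /=.
  by under eq_bigr do rewrite ffunE.
rewrite mulr_suml.
rewrite (sumr_fiber
  (fun o : {dffun forall j, Om j} => [ffun j => al j (o j)] : atuple A)
  (fun o a => ([ffun j => xi j (o j)] == y :> qtuple X)%:R *
    ((\prod_j w j (o j)) * (~~ V y a)%:R))).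
apply: eq_bigr => a _; rewrite mulrAC -big_split /=.
under eq_bigr do rewrite -phE.
rewrite -(bigA_distr_dffun
  (fun j u => ((xi j u == y j) && (al j u == a j))%:R * w j u)) mulr_suml.
apply: eq_bigr => o _; rewrite !mulrA; congr (_ * _).
rewrite !dffun_eqE -!prodr_bool -!big_split /=; apply: eq_bigr => j _.
by rewrite !ffunE andbC -mulnb natrM.
Qed.

End Resampling.

(** * Decoupling of coordinates and convexity estimates for the exponential *)

(* Exchanging the coordinates outside [S] of two independent samples preserves
   their joint law, and makes the arguments of [g] independent. *)
Lemma sum_prod_outside_le (T : finType) (n : nat) (mu : T -> R)
    (S : {set 'I_n}) (g : 'I_n -> {ffun 'I_n -> T} -> T -> R) (c : R) :
    is_distr mu -> (forall i x y, 0 <= g i x y) ->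
    (forall i (x z : {ffun 'I_n -> T}), {in S, x =1 z} -> g i x = g i z) ->
    (forall i x, \sum_y mu y * g i x y <= c) ->
  \sum_(x : {ffun 'I_n -> T}) (\prod_i mu (x i)) *
     \prod_(i in ~: S) g i x (x i) <= c ^+ #|~: S|.
Proof.
move=> [mu_ge0 mu1] g_ge0 gS gc.
have M1 : \sum_(z : {ffun 'I_n -> T}) \prod_i mu (z i) = 1.
  by rewrite -(bigA_distr_bigA (fun=> mu)) big1.
pose mix (x z : {ffun 'I_n -> T}) := [ffun i => if i \in S then x i else z i].
pose sw (p : {ffun 'I_n -> T} * {ffun 'I_n -> T}) := (mix p.1 p.2, mix p.2 p.1).
have swK : involutive sw.
  by move=> [x z]; congr pair; apply/ffunP => i; rewrite !ffunE; case: (i \in S).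
have -> : \sum_(x : {ffun 'I_n -> T}) (\prod_i mu (x i)) *
     \prod_(i in ~: S) g i x (x i)
  = \sum_(x : {ffun 'I_n -> T}) (\prod_i mu (x i)) *
     \prod_i \sum_y mu y * (if i \in ~: S then g i x y else 1).
  transitivity (\sum_(x : {ffun 'I_n -> T}) \sum_(z : {ffun 'I_n -> T})
      (\prod_i mu (x i)) * (\prod_i mu (z i)) * \prod_(i in ~: S) g i x (x i)).
    apply: eq_bigr => x _; rewrite -mulr_suml -mulr_sumr M1 mulr1 //.
  rewrite pair_big (reindex_inj (inv_inj swK)) /=.
  rewrite -(pair_big predT predT (fun x z =>
    (\prod_i mu (mix x z i)) * (\prod_i mu (mix z x i)) *
     \prod_(i in ~: S) g i (mix x z) (mix x z i))) /=.
  apply: eq_bigr => x _.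
  rewrite (bigA_distr_bigA (fun i y =>
    mu y * (if i \in ~: S then g i x y else 1))) mulr_sumr.
  apply: eq_bigr => z _; rewrite [in RHS]big_split /= mulrA; congr (_ * _).
    rewrite -!big_split /=; apply: eq_bigr => i _; rewrite !ffunE.
    by case: ifP => // _; rewrite mulrC.
  rewrite big_mkcond /=; apply: eq_bigr => i _; case: ifP => // iS.
  rewrite (gS i (mix x z) x) => [|l lS]; rewrite !ffunE ?lS //.
  by move: iS; rewrite inE => /negbTE ->.
rewrite -[leRHS]mul1r -[X in _ <= X * _]M1 mulr_suml; apply: ler_sum => x _.
apply: ler_wpM2l; first by apply: prodr_ge0.
rewrite -prodr_const big_mkcond [leRHS]big_mkcond /=; apply: ler_prod => i _.
apply/andP; split.
  by apply: sumr_ge0 => y _; rewrite mulr_ge0 //; case: ifP.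
by case: ifP => // _; under eq_bigr do rewrite mulr1; rewrite mu1.
Qed.

(** Each exponential lies above the tangent line at the mean [M], and the linear term averages to
    zero. The weights [p] need not sum to 1. *)
Lemma jensen_expR (I : finType) (p F : I -> R) :
    (forall i, 0 <= p i) -> 0 < \sum_i p i ->
  (\sum_i p i) * expR (- ((\sum_i p i * F i) / \sum_i p i))
    <= \sum_i p i * expR (- F i).
Proof.
move=> p_ge0 P_gt0; set P := \sum_i p i; set M := (\sum_i _) / P.
have -> : P * expR (- M) = \sum_i p i * (expR (- M) * (1 + (M - F i))).
  under [RHS]eq_bigr do rewrite mulrCA.
  rewrite -mulr_sumr [LHS]mulrC; congr (_ * _).
  under [RHS]eq_bigr do rewrite mulrDr mulr1 mulrBr.
  by rewrite big_split sumrB /= -mulr_suml mulrC divfK ?gt_eqF // subrr addr0.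
apply: ler_sum => i _; apply: ler_wpM2l => //.
rewrite (_ : expR (- F i) = expR (- M + (M - F i))); last by congr expR; ring.
by rewrite expRD ler_wpM2l ?expR_ge0 ?expR_ge1Dx.
Qed.

(** By convexity between [- lam] and 0. It makes exponentials linear in the losing probability, of
    which only the mean is controlled. *)
Lemma expR_chord (lam t : R) : 0 <= t <= 1 ->
  expR (- (lam * t)) <= 1 - (1 - expR (- lam)) * t.
Proof.
case/andP=> t0 t1.
have := convex_expR (Itv01 t0 t1) (- lam : R^o) (0 : R^o).
rewrite !convRE /= expR0 mulr0 addr0 /onem => /le_trans.
rewrite mulrN [t * lam]mulrC; apply.
by rewrite le_eqVlt; apply/orP; left; apply/eqP; ring.
Qed.

(** * The repeated game under a fixed strategy *)

Section Repeated.
Variables (k : nat) (X A : 'I_k -> finType).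
Variables (mu : qtuple X -> R) (V : qtuple X -> atuple A -> bool) (v : R).
Variable muj : forall j : 'I_k, X j -> R.
Hypothesis mu_distr : is_distr mu.
Hypothesis muj_ge0 : forall j y, 0 <= muj (j := j) y.
Hypothesis muE : forall x : qtuple X, mu x = \prod_j muj (x j).
Hypothesis win_le : forall h : strategy X A, win_prob mu V h <= v.
Variables (n : nat) (H : strategy (@repX k n X) (@repA k n A)).

(** The game stores questions player by player; independence of the [n] samples is visible
    coordinate by coordinate. *)
Definition transpose_tuple (x : {ffun 'I_n -> qtuple X}) :
  qtuple (@repX k n X) := [ffun j => [ffun i => x i j]].

Lemma qcoord_transpose x i : qcoord (transpose_tuple x) i = x i.
Proof. by apply/ffunP => j; rewrite !ffunE. Qed.

Lemma transpose_tuple_bij : bijective transpose_tuple.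
Proof.
exists (fun xs => [ffun i => qcoord xs i]) => [x|xs].
  by apply/ffunP => i; rewrite ffunE qcoord_transpose.
by apply/ffunP => j; apply/ffunP => i; rewrite !ffunE.
Qed.

Lemma sum_rep_muE (F : qtuple (@repX k n X) -> R) :
  \sum_xs rep_mu mu xs * F xs =
  \sum_(x : {ffun 'I_n -> qtuple X}) (\prod_i mu (x i)) * F (transpose_tuple x).
Proof.
rewrite (reindex transpose_tuple); last exact/onW_bij/transpose_tuple_bij.
apply: eq_bigr => x _; congr (_ * _); apply: eq_bigr => i _.
by rewrite qcoord_transpose.
Qed.

Lemma rep_mu_ge0 xs : 0 <= @rep_mu k n X mu xs.
Proof. by apply: prodr_ge0 => i _; apply: mu_distr.1. Qed.

Lemma rep_muE xs : @rep_mu k n X mu xs = \prod_j \prod_i muj (xs j i).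
Proof.
rewrite exchange_big; apply: eq_bigr => i _ /=; rewrite muE.
by apply: eq_bigr => j _; rewrite ffunE.
Qed.

Lemma sum_rep_mu : \sum_xs @rep_mu k n X mu xs = 1.
Proof.
under eq_bigr do rewrite -[rep_mu _ _]mulr1.
rewrite (sum_rep_muE (fun=> 1)); under eq_bigr do rewrite mulr1.
by rewrite -(bigA_distr_bigA (fun=> mu)) big1 // => i _; apply: mu_distr.2.
Qed.

Definition wins (xs : qtuple (@repX k n X)) (i : 'I_n) : bool :=
  V (qcoord xs i) (acoord (answers H xs) i).

Definition wins_prob (S : {set 'I_n}) : R :=
  \sum_xs rep_mu mu xs * ([forall i in S, wins xs i])%:R.

Definition loses_prob (S : {set 'I_n}) (i : 'I_n) : R :=
  \sum_xs rep_mu mu xs * ([forall i in S, wins xs i])%:R * (~~ wins xs i)%:R.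

Lemma wins_prob0 : wins_prob finset.set0 = 1.
Proof.
rewrite -[RHS]sum_rep_mu; apply: eq_bigr => xs _.
have -> : [forall i in finset.set0, wins xs i] by apply/forall_inP => i; rewrite inE.
by rewrite mulr1.
Qed.

Lemma wins_probU1 S i : wins_prob (i |: S) = wins_prob S - loses_prob S i.
Proof.
rewrite /wins_prob -sumrB; apply: eq_bigr => xs _.
rewrite -mulrA -mulrBr -natrM mulnb; congr (_ * _).
have -> : [forall l in i |: S, wins xs l]
    = wins xs i && [forall l in S, wins xs l].
  apply/forall_inP/andP => [W|[Wi /forall_inP W] l].
    split; first by apply: W; rewrite setU11.
    by apply/forall_inP => l lS; apply: W; rewrite setU1r.
  by rewrite !inE => /predU1P [->//|]; apply: W.
by case: (wins xs i); case: [forall l in S, _]; rewrite ?(subrr, subr0).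
Qed.

Lemma wins_prob_setT_le S : wins_prob [set: 'I_n] <= wins_prob S.
Proof.
apply: ler_sum => xs _; apply: ler_wpM2l; first exact: rep_mu_ge0.
rewrite ler_nat; case: forall_inP => // W.
by have -> : [forall i in S, wins xs i] by apply/forall_inP => i _; apply: W.
Qed.

Lemma win_prob_rep : win_prob (@rep_mu k n X mu) (@rep_V k n X A V) H
  = wins_prob [set: 'I_n].
Proof.
apply: eq_bigr => xs _; congr (_ * (nat_of_bool _)%:R).
by apply: eq_forallb => i; rewrite inE.
Qed.

Let CA : R := \prod_j #|A j|%:R.

Lemma sum_atuple_rep m : \sum_(b : atuple (@repA k m A)) 1 = CA ^+ m :> R.
Proof.
transitivity (\sum_(b : atuple (@repA k m A)) \prod_(j < k) (1 : R)).
  by apply: eq_bigr => b _; rewrite big1_eq.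
rewrite (bigA_distr_dffun (fun j (_ : @repA k m A j) => 1)) /CA -prodrXl.
by apply: eq_bigr => j _; rewrite sumr_const card_ffun card_ord natrX.
Qed.

(** On a random question, the expected number [q] of accepted answer tuples is at most [CA * v],
    since each tuple is a constant strategy. A win in every coordinate needs an accepted tuple in
    each, whence the power. *)
Lemma wins_prob_setT_le_card :
  wins_prob [set: 'I_n] <= (CA * v) ^+ n.
Proof.
pose q := \sum_y mu y * \sum_(a : atuple A) (V y a)%:R.
have q_ge0 : 0 <= q.
  apply: sumr_ge0 => y _; rewrite mulr_ge0 ?(proj1 mu_distr) // sumr_ge0 //.
have q_le : q <= CA * v.
  have -> : q = \sum_(a : atuple A)
      win_prob mu V ([ffun j => [ffun=> a j]] : strategy X A).
    rewrite /q; under eq_bigr do rewrite mulr_sumr.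
    rewrite exchange_big; apply: eq_bigr => a _; apply: eq_bigr => y _ /=.
    by congr (_ * (V _ _)%:R); apply/ffunP => j; rewrite !ffunE.
  have -> : CA * v = \sum_(a : atuple A) v.
    rewrite /CA -[v in RHS]mul1r -mulr_suml; congr (_ * _).
    transitivity (\sum_(a : atuple A) \prod_(j < k) (1 : R)).
      rewrite (bigA_distr_dffun (fun j (_ : A j) => 1)).
      by apply: eq_bigr => j _; rewrite sumr_const.
    by apply: eq_bigr => b _; rewrite big1_eq.
  by apply: ler_sum => a _; apply: win_le.
apply: (@le_trans _ _ (q ^+ n)); last by rewrite lerXn2r ?nnegrE ?(le_trans q_ge0).
have -> : q ^+ n = \prod_(i < n) q by rewrite prodr_const card_ord.
rewrite /q (bigA_distr_bigA (fun _ : 'I_n =>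
  fun y => mu y * \sum_(a : atuple A) (V y a)%:R)).
rewrite /wins_prob sum_rep_muE; apply: ler_sum => x _.
rewrite big_split /=; apply: ler_wpM2l.
  by apply: prodr_ge0 => i _; apply: mu_distr.1.
case: forall_inP => W; last by apply: prodr_ge0 => i _; apply: sumr_ge0.
apply: (@le_trans _ _ (\prod_(i < n) (1 : R))); first by rewrite big1_eq.
apply: ler_prod => i _.
rewrite ler01 /=.
have := W i (finset.in_setT _); rewrite /wins qcoord_transpose => Wi.
by rewrite (bigD1 (acoord (answers H (transpose_tuple x)) i)) //= Wi lerDl sumr_ge0.
Qed.

Variable a0 : forall j, A j.

(** * Conditioning on winning the coordinates in [S] *)

Section Conditioning.
Variable S : {set 'I_n}.

(** Numbering [S] by [enum_val] turns the data on [S] into tuples of a smaller repeated game, so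
    [sum_atuple_rep] counts the answers. *)
Definition restrict_q (xs : qtuple (@repX k n X)) : qtuple (@repX k #|S| X) :=
  [ffun j => [ffun t => xs j (enum_val t)]].
Definition restrict_a (b : atuple (@repA k n A)) : atuple (@repA k #|S| A) :=
  [ffun j => [ffun t => b j (enum_val t)]].

Lemma wins_restrict xs :
  [forall i in S, wins xs i]
  = rep_V V (restrict_q xs) (restrict_a (answers H xs)).
Proof.
have E (t : 'I_#|S|) :
    V (qcoord (restrict_q xs) t) (acoord (restrict_a (answers H xs)) t)
    = wins xs (enum_val t).
  by rewrite /wins; congr (V _ _); apply/ffunP => j; rewrite !ffunE.
apply/forall_inP/forallP => [W t|W i iS].
  by rewrite E; apply: W; apply: enum_valP.
by have := W (enum_rank_in iS i); rewrite E enum_rankK_in.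
Qed.

(* Freeness: given the questions and answers on [S], the remaining questions
   stay independent across players, so each player can resample alone. *)
Lemma conditional_resampling : exists f : 'I_n ->
    qtuple (@repX k #|S| X) -> atuple (@repA k #|S| A) -> qtuple X -> R,
  [/\ forall i z b y, 0 <= f i z b y <= 1,
      forall i z b, 1 - v <= \sum_y mu y * f i z b y &
      forall i, \sum_xs rep_mu mu xs * ([forall l in S, wins xs l])%:R *
        f i (restrict_q xs) (restrict_a (answers H xs)) (qcoord xs i)
      = loses_prob S i].
Proof.
pose key xs := (restrict_q xs, restrict_a (answers H xs)).
(* Winning on [S] is a function of [key], so it suffices to treat each value of [key] separately. *)
suff /choice [f fP] : forall q : 'I_n *
    (qtuple (@repX k #|S| X) * atuple (@repA k #|S| A)),
  exists f : qtuple X -> R,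
    [/\ forall y, 0 <= f y <= 1, 1 - v <= \sum_y mu y * f y &
     \sum_xs (key xs == q.2)%:R * (rep_mu mu xs * f (qcoord xs q.1))
     = \sum_xs (key xs == q.2)%:R * (rep_mu mu xs * (~~ wins xs q.1)%:R)].
  exists (fun i z b => f (i, (z, b))); split => [i z b|i z b|i].
  - by case: (fP (i, (z, b))).
  - by case: (fP (i, (z, b))).
  rewrite /loses_prob.
  under eq_bigr do rewrite wins_restrict.
  under [RHS]eq_bigr do rewrite wins_restrict.
  rewrite (sumr_fiber key (fun xs q =>
    rep_mu mu xs * (rep_V V q.1 q.2)%:R * f (i, (q.1, q.2)) (qcoord xs i))).
  rewrite (sumr_fiber key (fun xs q =>
    rep_mu mu xs * (rep_V V q.1 q.2)%:R * (~~ wins xs i)%:R)).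
  apply: eq_bigr => -[z b] _ /=; have [_ _ /= E] := fP (i, (z, b)).
  transitivity ((rep_V V z b)%:R * \sum_xs (key xs == (z, b))%:R *
    (rep_mu mu xs * f (i, (z, b)) (qcoord xs i))).
    by rewrite mulr_sumr; apply: eq_bigr => xs _; ring.
  by rewrite E mulr_sumr; apply: eq_bigr => xs _; ring.
move=> [i [z b]] /=.
(* Agreement with [(z, b)] is a separate condition for each player, so together with freeness the
   conditioned weight is a product over players. *)
pose w j (u : @repX k n X j) : R := (\prod_l muj (u l)) *
  (([ffun t => u (enum_val t)] == z j) &&
   ([ffun t => H j u (enum_val t)] == b j))%:R.
have w_ge0 j u : 0 <= w j u by rewrite mulr_ge0 // prodr_ge0.
have wE (xs : qtuple (@repX k n X)) :
    \prod_j w j (xs j) = (key xs == (z, b))%:R * rep_mu mu xs.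
  rewrite big_split /= prodr_bool -rep_muE mulrC.
  congr ((nat_of_bool _)%:R * _); rewrite /key xpair_eqE !dffun_eqE.
  apply/forallP/andP => [W|[/forallP W1 /forallP W2] j].
    by split; apply/forallP => j; have /andP[] := W j; rewrite !ffunE.
  by have := W1 j; have := W2 j; rewrite !ffunE => -> ->.
have [f [f01 fv fE]] := @resampling k X A mu V v win_le
  (@repX k n X) w (fun j u => u i) (fun j u => H j u i) a0
  (proj2 mu_distr) w_ge0.
exists f; split => //.
transitivity (\sum_xs (\prod_j w j ((xs : qtuple (@repX k n X)) j)) *
  f (qcoord xs i)).
  by apply: eq_bigr => xs _; rewrite wE mulrA.
transitivity (\sum_xs (\prod_j w j ((xs : qtuple (@repX k n X)) j)) *
  (~~ wins xs i)%:R); last by apply: eq_bigr => xs _; rewrite wE mulrA.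
rewrite (sumr_fiber (fun xs => qcoord xs i)
  (fun xs y => (\prod_j w j ((xs : qtuple (@repX k n X)) j)) * f y)).
rewrite (sumr_fiber (fun xs => qcoord xs i)
  (fun xs y => (\prod_j w j ((xs : qtuple (@repX k n X)) j)) *
     (~~ V y (acoord (answers H xs) i))%:R)).
apply: eq_bigr => y _.
transitivity (f y * \sum_(xs : qtuple (@repX k n X))
    (qcoord xs i == y)%:R * \prod_j w j (xs j)).
  by rewrite mulr_sumr; apply: eq_bigr => xs _; ring.
rewrite fE; apply: eq_bigr => xs _; congr (_ * (_ * (~~ V y _)%:R)).
by apply/ffunP => j; rewrite !ffunE.
Qed.

Lemma wins_prob_expR_le (lam c : R) :
    0 <= lam -> 1 - (1 - expR (- lam)) * (1 - v) <= c -> 0 < wins_prob S ->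
  wins_prob S *
    expR (- (lam * (\sum_(i in ~: S) loses_prob S i) / wins_prob S))
  <= CA ^+ #|S| * c ^+ #|~: S|.
Proof.
move=> lam0 hc P_gt0.
have [f [f01 fv fE]] := conditional_resampling.
pose p xs := rep_mu mu xs * ([forall i in S, wins xs i])%:R.
pose F xs b := \sum_(i in ~: S) lam * f i (restrict_q xs) b (qcoord xs i).
have p_ge0 xs : 0 <= p xs by rewrite mulr_ge0 ?rep_mu_ge0.
have := @jensen_expR _ p (fun xs => F xs (restrict_a (answers H xs))) p_ge0 P_gt0.
have -> : \sum_xs p xs * F xs (restrict_a (answers H xs))
    = lam * \sum_(i in ~: S) loses_prob S i.
  under eq_bigr do rewrite /F mulr_sumr.
  rewrite exchange_big mulr_sumr; apply: eq_bigr => i _ /=.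
  by rewrite -fE mulr_sumr; apply: eq_bigr => xs _; rewrite /p; ring.
move=> /le_trans; apply.
(* The answers on [S] depend on all questions; summing over every possible [b] removes this
   dependence at the cost of [CA ^+ #|S|]. *)
apply: (@le_trans _ _ (\sum_(b : atuple (@repA k #|S| A)) c ^+ #|~: S|)); last first.
  rewrite -sum_atuple_rep mulr_suml; apply: ler_sum => b _; rewrite mul1r //.
apply: (@le_trans _ _ (\sum_(b : atuple (@repA k #|S| A))
    \sum_xs rep_mu mu xs * expR (- F xs b))).
  rewrite exchange_big; apply: ler_sum => xs _ /=.
  rewrite (bigD1 (restrict_a (answers H xs))) //= -[leLHS]addr0; apply: lerD.
    rewrite ler_wpM2r ?expR_ge0 // /p -[leRHS]mulr1 ler_wpM2l ?rep_mu_ge0 //.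
    by rewrite lern1 leq_b1.
  by apply: sumr_ge0 => b _; rewrite mulr_ge0 ?rep_mu_ge0 ?expR_ge0.
apply: ler_sum => b _; rewrite sum_rep_muE.
(* With [b] fixed, [g i x] reads [x] on [S] only, as decoupling requires. *)
pose g i x y := expR (- (lam * f i (restrict_q (transpose_tuple x)) b y)).
apply: le_trans (@sum_prod_outside_le _ _ mu S g c mu_distr _ _ _).
- apply: ler_sum => x _; apply: ler_wpM2l.
    by apply: prodr_ge0 => i _; apply: mu_distr.1.
  rewrite /F -sumrN expR_sum le_eqVlt; apply/orP; left; apply/eqP.
  by apply: eq_bigr => i _; rewrite qcoord_transpose.
- by move=> i x y; apply: expR_ge0.
- move=> i x z xz; rewrite /g.
  suff -> : restrict_q (transpose_tuple x) = restrict_q (transpose_tuple z) by [].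
  by apply/ffunP => j; apply/ffunP => t; rewrite !ffunE xz // enum_valP.
move=> i x; apply: le_trans hc.
pose z := restrict_q (transpose_tuple x).
apply: (@le_trans _ _ (\sum_y mu y * (1 - (1 - expR (- lam)) * f i z b y))).
  apply: ler_sum => y _; apply: ler_wpM2l; first exact: mu_distr.1.
  exact: expR_chord.
under eq_bigr do rewrite mulrBr mulr1 mulrCA.
rewrite sumrB -mulr_sumr (proj2 mu_distr) lerD2l lerN2 ler_wpM2l //.
by rewrite subr_ge0 expR_le1 oppr_le0.
Qed.

End Conditioning.

(** * Extending the set of won coordinates *)

(** Taking logarithms in [wins_prob_expR_le] bounds the total losing probability outside [S] from
    below, and some coordinate reaches the average. *)
Lemma exists_losing_coordinate (S : {set 'I_n}) (lam theta Lam B eta : R) :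
    0 < lam -> 1 - (1 - expR (- lam)) * (1 - v) <= expR (- theta) ->
    CA <= expR Lam -> expR (- B) <= wins_prob S -> (0 < #|~: S|)%N ->
    #|S|%:R * Lam + B + lam * eta * #|~: S|%:R <= #|~: S|%:R * theta ->
  exists2 i, i \notin S & eta * wins_prob S <= loses_prob S i.
Proof.
move=> lam_gt0 hlam CALam hB N_gt0 hN.
have P_gt0 : 0 < wins_prob S by apply: lt_le_trans hB; apply: expR_gt0.
have CA_ge0 : 0 <= CA by apply: prodr_ge0.
set D := \sum_(i in ~: S) loses_prob S i.
have D_ge : lam * (#|~: S|%:R * (eta * wins_prob S)) <= lam * D.
  have := wins_prob_expR_le (ltW lam_gt0) hlam P_gt0; rewrite -/D => hD.
  have : expR (- B - lam * D / wins_prob S)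
      <= expR (#|S|%:R * Lam - #|~: S|%:R * theta).
    rewrite !expRD -[- (#|~: S|%:R * theta)]mulrN !expRM_natl.
    apply: le_trans (le_trans hD _).
      by rewrite ler_wpM2r ?expR_ge0.
    by rewrite ler_wpM2r ?exprn_ge0 ?expR_ge0 // lerXn2r ?nnegrE ?expR_ge0.
  rewrite ler_expR => hle.
  have : lam * eta * #|~: S|%:R <= lam * D / wins_prob S by lra.
  rewrite ler_pdivlMr //; apply: le_trans.
  by rewrite le_eqVlt; apply/orP; left; apply/eqP; ring.
rewrite ler_pM2l // in D_ge.
have [/existsP[i /andP[iS hi]]|noi] :=
  boolP [exists i, (i \notin S) && (eta * wins_prob S <= loses_prob S i)].
  by exists i.
suff : D < #|~: S|%:R * (eta * wins_prob S) by rewrite ltNge D_ge.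
rewrite mulr_natl -sumr_const; apply: ltr_sum => [|i].
  by move: N_gt0 => /card_gt0P[i iS]; apply/hasP; exists i; rewrite ?mem_index_enum.
rewrite inE => iS; rewrite ltNge; apply/negP => hi.
by move/negP: noi; apply; apply/existsP; exists i; rewrite iS.
Qed.

(* [y] is the number of extensions, [eta] the relative gain of each. *)
Lemma wins_prob_setT_le_expR (lam theta Lam B eta y : R) :
    0 < lam -> 1 - (1 - expR (- lam)) * (1 - v) <= expR (- theta) ->
    CA <= expR Lam -> 0 <= Lam -> 0 <= eta <= 1 -> lam * eta <= theta ->
    0 <= y < n%:R -> y * Lam + B <= (n%:R - y) * (theta - lam * eta) ->
    B <= eta * y ->
  wins_prob [set: 'I_n] <= expR (- B).
Proof.
move=> lam_gt0 hlam CALam Lam_ge0 /andP[eta_ge0 eta_le1] le_theta.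
(* Negating the goal gives every [S] winning probability above [expR (- B)], so the extension never
   gets stuck early. *)
move=> /andP[y_ge0 y_lt] hy hB; rewrite leNgt; apply/negP => PB.
have iter m : (forall l, (l < m)%N -> l%:R <= y) ->
    exists2 S : {set 'I_n}, #|S| = m & wins_prob S <= (1 - eta) ^+ m.
  elim: m => [_|m IH hm].
    by exists finset.set0; rewrite ?finset.cards0 ?wins_prob0.
  have [l lm|S Sm PS] := IH; first by apply: hm; apply: ltnW.
  have my : m%:R <= y by apply: hm.
  have mn : (m < n)%N by rewrite -(ltr_nat R); apply: le_lt_trans y_lt.
  have cS : #|~: S| = (n - m)%N by rewrite cardsCs finset.setCK card_ord Sm.
  have [||i iS hi] := @exists_losing_coordinate S lam theta Lam B eta
    lam_gt0 hlam CALam (le_trans (ltW PB) (wins_prob_setT_le S)).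
  - by rewrite cS subn_gt0.
  - rewrite Sm cS natrB ?(ltnW mn) //.
    have : m%:R * Lam <= y * Lam by rewrite ler_wpM2r.
    have : (n%:R - y) * (theta - lam * eta)
        <= (n%:R - m%:R) * (theta - lam * eta).
      by rewrite ler_wpM2r ?subr_ge0 // lerD2l lerN2.
    by lra.
  exists (i |: S); first by rewrite cardsU1 iS Sm.
  rewrite wins_probU1 exprS.
  apply: (@le_trans _ _ ((1 - eta) * wins_prob S)); first by lra.
  by rewrite ler_wpM2l // subr_ge0.
(* A set of size at most [y] can be extended once more, so the final size exceeds [y] and the gain
   is at least [expR (eta * y)]. *)
have /andP[trle trgt] := truncn_itv y_ge0.
have [l lm|S _ PS] := iter (Num.truncn y).+1.
  by apply: le_trans trle; rewrite ler_nat.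
suff : wins_prob S <= expR (- B).
  by rewrite leNgt (lt_le_trans PB) // wins_prob_setT_le.
apply: le_trans PS _.
apply: (@le_trans _ _ (expR (- eta) ^+ (Num.truncn y).+1)).
  rewrite lerXn2r ?nnegrE ?expR_ge0 ?subr_ge0 //; exact: expR_ge1Dx.
rewrite -expRM_natl ler_expR mulrN lerN2; apply: le_trans hB _.
by rewrite mulrC ler_wpM2r // ltW.
Qed.

End Repeated.

(** * Bounds on the answer length *)

Lemma ln2_bounds : 2^-1 <= ln (2 : R) <= 1.
Proof.
have two : (2 : R) \is Num.pos by rewrite posrE.
apply/andP; split.
  rewrite -lerN2 -lnV //; have := @le_ln1Dx R (- 2^-1).
  by rewrite (_ : 1 + - 2^-1 = 2^-1 :> R); [apply|]; lra.
by have := @le_ln1Dx R 1; apply; lra.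
Qed.

Lemma answer_len_ge0 k (A : 'I_k -> finType) : 0 <= answer_len A.
Proof. by have /bigmax_leP[] := lexx (answer_len A). Qed.

(** Alphabet sizes are integers: if none reaches 2, all logarithms are at most 0. *)
Lemma answer_len_ge1 k (A : 'I_k -> finType) :
  0 < answer_len A -> 1 <= answer_len A.
Proof.
have /bigmax_leP[_ leA] := lexx (answer_len A).
have /andP[ln2_ge _] := ln2_bounds; have ln2_gt0 : 0 < ln 2 :> R by lra.
have [/existsP[j Aj] _|/existsPn A1] := boolP [exists j, 2 <= #|A j|]%N.
  apply: le_trans (leA j isT); rewrite /log2 ler_pdivlMr // mul1r.
  by rewrite ler_ln ?posrE ?ltr0n ?ler_nat // (leq_trans _ Aj).
rewrite ltNge => /negP[]; apply/bigmax_leP; split => // j _.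
rewrite /log2 ler_pdivrMr // mul0r; apply: ln_le0.
by rewrite -[leRHS]/(1%:R) ler_nat -ltnS ltnNge.
Qed.

Lemma prod_card_le_expR k (A : 'I_k -> finType) (a0 : forall j, A j) :
  \prod_j #|A j|%:R <= expR (answer_len A * k%:R * ln 2).
Proof.
have /bigmax_leP[_ leA] := lexx (answer_len A).
have /andP[ln2_ge _] := ln2_bounds; have ln2_gt0 : 0 < ln 2 :> R by lra.
rewrite mulrAC expRM_natr -[X in _ ^+ X]card_ord -prodr_const.
apply: ler_prod => j _; rewrite ler0n /=.
have Aj : 0 < #|A j|%:R :> R by rewrite ltr0n; apply/card_gt0P; exists (a0 j).
by rewrite -[leLHS]lnK ?posrE // ler_expR -ler_pdivrMr // leA.
Qed.

(** * Choice of parameters *)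

Lemma wins_prob_rep_le (k : nat) (X A : 'I_k -> finType)
    (mu : qtuple X -> R) (V : qtuple X -> atuple A -> bool) (c eps : R)
    (n : nat) (H : strategy (@repX k n X) (@repA k n A)) (a0 : forall j, A j) :
    is_distr mu -> free_distr mu ->
    (forall h : strategy X A, win_prob mu V h <= 1 - eps) ->
    0 <= c -> 1024 * c <= 1 -> 0 <= eps <= 1 ->
    (0 < n)%N -> 0 < answer_len A -> (0 < k)%N ->
  wins_prob mu V H [set: 'I_n] <=
    (1 - eps ^+ 2) `^ (c * n%:R / (answer_len A * k%:R)).
Proof.
move=> mu_distr [muj [muj_distr muE]] win_le c0 c1 /andP[eps0 eps1].
move=> n_gt0 s_gt0 k_gt0.
have muj_ge0 j y : 0 <= muj j y by case: (muj_distr j).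
have /andP[ln2_ge ln2_le] := ln2_bounds.
have s1 : 1 <= answer_len A * k%:R.
  have k1 : 1 <= k%:R :> R by rewrite ler1n.
  by rewrite -[leLHS]mulr1 ler_pM ?ler01 ?answer_len_ge1.
have CALam := prod_card_le_expR a0.
set s := answer_len A * k%:R in s1 CALam *.
have n1 : 1 <= n%:R :> R by rewrite ler1n.
set N : R := n%:R in n1 *.
have triv := wins_prob_setT_le_card mu_distr win_le H.
have main := wins_prob_setT_le_expR mu_distr muj_ge0 muE win_le H a0.
have CA_ge0 : 0 <= \prod_j #|A j|%:R :> R by apply: prodr_ge0.
(* For [eps = 1] the counting bound is already 0, as [n] is positive. *)
have [eps_lt1|] := ltP eps 1; last first.
  move=> eps_ge1; have v0 : 1 - eps = 0 by lra.
  apply: le_trans triv _; rewrite v0 mulr0 expr0n.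
  by rewrite gtn_eqF // powR_ge0.
have u_gt0 : 0 < 1 - eps ^+ 2 by nra.
rewrite /powR gt_eqF //.
set t := c * N / s.
pose l := - ln (1 - eps ^+ 2).
have -> : t * ln (1 - eps ^+ 2) = - (t * l) by rewrite /l; ring.
have l_ge0 : 0 <= l by rewrite /l oppr_ge0 ln_le0 //; nra.
have s_gt : 0 < s by lra.
have N_ge0 : 0 <= N by exact: le_trans n1.
have t_ge0 : 0 <= t by rewrite divr_ge0 ?(ltW s_gt) // mulr_ge0.
have cN_ge0 : 0 <= c * N by rewrite mulr_ge0.
have cN : 1024 * (c * N) <= N by rewrite mulrA ler_piMl.
have t_le : t <= c * N by rewrite ler_pdivrMr // ler_peMr.
set Lam := s * ln 2 in CALam.
have Lam_ge : 2^-1 <= Lam.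
  by apply: (le_trans ln2_ge); rewrite ler_peMl //; lra.
have Lam_le : Lam <= s by rewrite ler_piMr // ltW.
have Lam_gt0 : 0 < Lam by lra.
have tLam : t * Lam <= c * N.
  apply: (@le_trans _ _ (t * s)); first by rewrite ler_wpM2l.
  by rewrite /t divfK ?gt_eqF.
(* The cutoff serves both sides: below it [1 - eps ^+ 2] is at least 1/9, giving
   [l <= 9 * eps ^+ 2]; above it [1 - eps] is below 2^-4, giving [4 * ln 2 <= m]. *)
have [eps_le|eps_gt] := leP eps (15 / 16).
  have l_le : l <= 9 * eps ^+ 2.
    rewrite /l -lnV ?posrE //.
    have := @le_ln1Dx R ((1 - eps ^+ 2)^-1 - 1).
    rewrite addrCA subrr addr0 => /(_ _)/le_trans; apply.
      by rewrite ltrBrDl subrr invr_gt0.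
    rewrite lerBlDr; apply: (@le_trans _ _
      ((9 * eps ^+ 2 + 1) * (1 - eps ^+ 2) / (1 - eps ^+ 2))).
      rewrite -[leLHS]mul1r ler_pM2r ?invr_gt0 //.
      have e2 : eps ^+ 2 <= 225 / 256.
        have : eps * eps <= 15 / 16 * (15 / 16) by rewrite ler_pM.
        by lra.
      have : 0 <= eps ^+ 2 * (8 - 9 * eps ^+ 2).
        by rewrite mulr_ge0 ?sqr_ge0 //; lra.
      by lra.
    by rewrite mulfK // gt_eqF.
  (* This [y] caps the union-bound cost at [eps * N / 8], below the available decay of at least
     [3 / 4 * N * (3 / 8 * eps)]. *)
  have [y yLam] : exists y, y * Lam = eps * N / 8.
    by exists (eps * N / 8 / Lam); rewrite divfK ?gt_eqF.
  have epsN : 0 <= eps * N by rewrite mulr_ge0 //; lra.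
  have y_ge0 : 0 <= y by rewrite -(pmulr_lge0 _ Lam_gt0) yLam; lra.
  have y_le : y <= N / 4.
    have : y * 2^-1 <= y * Lam by rewrite ler_wpM2l.
    have : eps * N <= N by rewrite ler_piMl.
    by lra.
  have Bl : t * l <= t * (9 * eps ^+ 2) by rewrite ler_wpM2l.
  (* With [lam = 1], [1 - expR (-1)] is at least 1/2, whence [theta = eps / 2]. *)
  apply: (main 1 (eps / 2) Lam (t * l) (eps / 8) y); rewrite -/N => //.
  - have e1 : expR (-1) <= 2^-1 :> R.
      rewrite expRN lef_pV2 ?posrE ?expR_gt0 //; have := @expR_ge1Dx R 1; lra.
    by apply: le_trans (@expR_ge1Dx R _); nra.
  - exact: ltW.
  - lra.
  - lra.
  - by apply/andP; split => //; lra.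
  - have : t * (9 * eps ^+ 2) <= c * N * (9 * eps ^+ 2).
      by rewrite ler_wpM2r // mulr_ge0 ?sqr_ge0.
    have : eps * (eps * N) <= eps * N by rewrite ler_piMl.
    have : 1024 * (c * N) * (eps * eps) <= N * (eps * eps).
      by rewrite ler_wpM2r ?mulr_ge0.
    have : y * eps <= N / 4 * eps by rewrite ler_wpM2r.
    by lra.
  (* 72 is 9 from the bound on [l] times 8 from [eta = eps / 8]. *)
  have : 72 * t * eps <= y.
    rewrite -(ler_pM2r Lam_gt0) yLam.
    have : t * Lam * eps <= c * N * eps by rewrite ler_wpM2r.
    have : 1024 * (c * N) * eps <= N * eps by rewrite ler_wpM2r.
    by lra.
  move=> h; apply: le_trans Bl _.
  have : 72 * t * eps * eps <= y * eps by rewrite ler_wpM2r.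
  by lra.
have v_gt0 : 0 < 1 - eps by lra.
pose m := - ln (1 - eps).
have vE : 1 - eps = expR (- m) by rewrite /m opprK lnK ?posrE.
have l_le : l <= m by rewrite /l /m lerN2 ler_ln ?posrE //; nra.
have m_ge : 4 * ln 2 <= m.
  rewrite mulr_natl -lnXn // /m -lnV ?posrE // ler_ln ?posrE ?invr_gt0 ?exprn_gt0 //.
  by rewrite -[leLHS]invrK lef_pV2 ?posrE ?invr_gt0 ?exprn_gt0 //; lra.
have m_gt0 : 0 < m by lra.
have mN : 0 <= m * N by rewrite mulr_ge0 //; lra.
have cNm : 1024 * (c * N) * m <= N * m by rewrite ler_wpM2r // ltW.
have Bl : t * l <= t * m by rewrite ler_wpM2l.
have tm : t * m <= c * N * m by rewrite ler_wpM2r // ltW.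
(* When [Lam] is below [m / 2], the counting bound gives decay [expR (- (N * m / 2))]. Otherwise [y]
   below is at most [N / 8]. *)
have [Lam_big|Lam_small] := leP (m / 2) Lam; last first.
  apply: le_trans triv _.
  apply: (@le_trans _ _ ((expR Lam * expR (- m)) ^+ n)).
    by rewrite vE lerXn2r ?nnegrE ?mulr_ge0 ?expR_ge0 // ler_wpM2r ?expR_ge0.
  rewrite -expRD -expRM_natl ler_expR -/N.
  have : N * Lam <= N * (m / 2) by rewrite ler_wpM2l // ltW.
  by lra.
have [y yLam] : exists y, y * Lam = m * N / 16.
  by exists (m * N / 16 / Lam); rewrite divfK ?gt_eqF.
have y_ge0 : 0 <= y by rewrite -(pmulr_lge0 _ Lam_gt0) yLam; lra.
have y_le : y <= N / 8.
  rewrite -(ler_pM2r Lam_gt0) yLam.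
  have : N * (m / 2) <= N * Lam by rewrite ler_wpM2l.
  by lra.
(* With [lam = m] the hypothesis on [theta] reads [1 - eps ^+ 2 <= expR (- theta)]. The left side is
   at most [2 * expR (- m)], and [ln 2 <= m / 4] absorbs the 2. *)
apply: (main m (3 / 4 * m) Lam (t * l) 2^-1 y); rewrite -/N => //.
- rewrite -vE; apply: (@le_trans _ _ (2 * (1 - eps))).
    by have := sqr_ge0 (1 - eps); lra.
  rewrite vE -[X in X * _]lnK ?posrE // -expRD ler_expR; lra.
- exact: ltW.
- lra.
- lra.
- by apply/andP; split => //; lra.
- have : y * m <= N / 8 * m by rewrite ler_wpM2r // ltW.
  by lra.
apply: le_trans Bl _; rewrite -(ler_pM2r Lam_gt0).
have : t * Lam * m <= c * N * m by rewrite ler_wpM2r // ltW.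
lra.
Qed.

Theorem theorem1p4 :
  exists c : R, 0 < c /\
  forall (k : nat) (X A : 'I_k -> finType)
         (mu : qtuple X -> R) (V : qtuple X -> atuple A -> bool) (eps : R),
    is_distr mu ->
    free_distr mu ->
    game_val mu V = 1 - eps ->
    forall n : nat, (1 <= n)%N ->
      game_val (@rep_mu k n X mu) (@rep_V k n X A V)
        <= (1 - eps ^+ 2) `^ (c * n%:R / (answer_len A * k%:R)).
Proof.
have [c [c0 c1]] : exists c : R, 0 < c /\ 1024 * c <= 1.
  by exists 1024^-1; split; lra.
exists c; split => //.
move=> k X A mu V eps mu_distr mu_free valE n n1.
have /bigmax_leP[val_ge0 win_le] := lexx (game_val mu V).
have eps0 : 0 <= eps.
  suff : game_val mu V <= 1 by rewrite valE; lra.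
  apply/bigmax_leP; split => // h _; rewrite -(proj2 mu_distr).
  apply: ler_sum => x _; rewrite -[leRHS]mulr1 ler_wpM2l ?(proj1 mu_distr) //.
  by rewrite lern1 leq_b1.
apply/bigmax_leP; split => [|H _]; first exact: powR_ge0.
rewrite win_prob_rep.
(* Total mass 1 excludes an empty question set; the strategy's reply to a constant question then
   supplies default answers. *)
have [x0 _|X0] := pickP (@predT (qtuple X)); last first.
  have := proj2 mu_distr; rewrite big1 => [/eqP|x _]; last by have := X0 x.
  by rewrite eq_sym oner_eq0.
have a0 j : A j := H j [ffun=> x0 j] (Ordinal n1).
have [s_gt0|s_le0] := ltP 0 (answer_len A); last first.
  (* Division by 0 yields 0, so the exponent vanishes and the claim is that a probability is at most
     1. *)
  have -> : answer_len A = 0 by apply/le_anti; rewrite s_le0 answer_len_ge0.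
  rewrite mul0r invr0 mulr0 powRr0 -(wins_prob0 V mu_distr H).
  exact: wins_prob_setT_le.
have k_gt0 : (0 < k)%N.
  by case: k A s_gt0 {X mu V mu_distr mu_free valE val_ge0 win_le H x0 a0} => // A;
     rewrite /answer_len big_ord0 ltxx.
apply: wins_prob_rep_le => //.
- by move=> h; rewrite -valE win_le.
- exact: ltW.
by rewrite eps0 /=; move: val_ge0; rewrite valE; lra.
Qed.
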